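(* Let $(\mathfrak g,\omega_{\mathfrak g})$ be a restricted periplectic quasi-Frobenius Lie superalgebra. Suppose that there exists $0\neq x\in([\mathfrak g,\mathfrak g])^\perp_{\bar 1}$ such that $\mathscr K:=\mathrm{Span}\{x\}$ is an ideal and $\mathscr K^\perp$ is a $p$-ideal. Then $(\mathfrak g,\omega_{\mathfrak g})$ is obtained as a symplectic $\mathscr D_{\bar 0}$-extension from a restricted periplectic quasi-Frobenius Lie superalgebra $(\mathfrak a,\omega_{\mathfrak a})$.
   Context: $\mathbb K$ is a field of characteristic $p>2$. Lie superalgebras $\mathfrak a=\mathfrak a_{\bar 0}\oplus\mathfrak a_{\bar 1}$ are finite-dimensional over $\mathbb K$; $[u,[u,u]]=0$ for odd $u$ is part of the definition (needed if $p=3$). $|u|$ is the parity of $u$; formulas with parities are for homogeneous elements. A $p$-structure on a Lie algebra $L$ is a map $a\mapsto a^{[p]}$ with $\mathrm{ad}_{a^{[p]}}=(\mathrm{ad}_a)^p$, $(\alpha a)^{[p]}=\alpha^pa^{[p]}$, $(a+b)^{[p]}=a^{[p]}+b^{[p]}+\sum_{i=1}^{p-1}s_i(a,b)$, where $(\mathrm{ad}_{\mu a+b})^{p-1}(a)=\sum_{i=1}^{p-1}i\,s_i(a,b)\mu^{i-1}$. A $p|2p$-map on $\mathfrak a$ is a $p$-structure on $\mathfrak a_{\bar 0}$ with $\mathrm{ad}_{a^{[p]}}(b)=(\mathrm{ad}_a)^p(b)$ for all $a\in\mathfrak a_{\bar 0}$, $b\in\mathfrak a$. $\mathfrak a$ with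 a $p|2p$-map is called restricted. A homogeneous ideal $I$ is a $p$-ideal if $a^{[p]}\in I_{\bar 0}$ for all $a\in I_{\bar 0}$. A bilinear form $\omega$ is (super) anti-symmetric if $\omega(a,b)=-(-1)^{|a||b|}\omega(b,a)$, and closed if $(-1)^{|a||c|}\omega(a,[b,c])+(-1)^{|c||b|}\omega(c,[a,b])+(-1)^{|b||a|}\omega(b,[c,a])=0$. $(\mathfrak a,\omega)$ is quasi-Frobenius if $\omega$ is a non-degenerate closed anti-symmetric form; periplectic if $\omega$ is odd ($\omega(\mathfrak a_{\bar 0},\mathfrak a_{\bar 0})=\omega(\mathfrak a_{\bar 1},\mathfrak a_{\bar 1})=0$). $S^\perp=\{v:\omega(v,w)=0\ \forall w\in S\}$, and $S^\perp_{\bar 1}$ is its odd part. The adjoint $\mathscr D^*$ of a derivation $\mathscr D$ is defined by $\omega(\mathscr D(a),b)=(-1)^{|a||\mathscr D|}\omega(a,\mathscr D^*(b))$. $\mathscr D$ is restricted if $\mathscr D(a^{[p]})=(\mathrm{ad}_a)^{p-1}(\mathscr D(a))$ for all $a\in\mathfrak a_{\bar 0}$. For an anti-symmetric bilinear $\alpha:\mathfrak a\times\mathfrak a\to\mathbb K$, a map $\beta:\mathfrak a_{\bar 0}\to\mathbb K$ has the $*$-property with respect to $\alpha$ if $\beta(\delta a)=\delta^p\beta(a)$ and $\beta(a+b)=\beta(a)+\beta(b)+\sum\frac1{\pi\{a\}}\alpha([[\dots[x_1,x_2],x_3]\dots,x_{p-1}],x_p)$, the sum over all choices $x_i\in\{a,b\}$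 with $x_1=a$, $x_2=b$, $\pi\{a\}$ being the number of $x_i$ equal to $a$. $B^2_*(\mathfrak a;\mathbb K)$ is the set of pairs $(\alpha,\beta)$ such that $\beta$ has the $*$-property with respect to $\alpha$ and there is a linear $\varphi:\mathfrak a\to\mathbb K$ with $\alpha(a,b)=\varphi([a,b])$, $\beta(a)=\varphi(a^{[p]})$. Symplectic $\mathscr D_{\bar 0}$-extension (periplectic case). Data: a restricted periplectic quasi-Frobenius $(\mathfrak a,\omega_{\mathfrak a})$; an even restricted derivation $\mathscr D$ of $\mathfrak a$ with $\gamma\in\mathbb K$, $a_0\in\mathfrak a_{\bar 0}$ such that $\mathscr D^p=\gamma\mathscr D+\mathrm{ad}_{a_0}$, $\mathscr D(a_0)=0$; $\lambda\in\mathbb K$ such that $(\Omega,0)\in B^2_*(\mathfrak a;\mathbb K)$, where $\Omega(a,b)=\omega_{\mathfrak a}((\mathscr D^2+2\mathscr D^*\mathscr D+(\mathscr D^* )^2+\lambda\mathscr D+\lambda\mathscr D^* )(a),b)$; $Z_\Omega\in\mathfrak a_{\bar 0}$ with $\Omega(a,b)=\omega_{\mathfrak a}(Z_\Omega,[a,b])$ and $\omega_{\mathfrak a}(Z_\Omega,a^{[p]})=0$ for $a\in\mathfrak a_{\bar 0}$; and $\lambda\gamma=\lambda^p$, $\omega_{\mathfrak a}(Z_\Omega,a_0)=0$, $\sum_{i+j=p-1}(-\lambda)^j(\mathscr D^* )^i(Z_\Omega)=\mathscr D^*(a_0)+\gamma Z_\Omega$. The extension is $\mathfrak g=\mathbb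 Kx\oplus\mathfrak a\oplus\mathbb Ke$ with $x$ odd, $e$ even, bracket $[x,e]=\lambda x$, $[x,a]=[x,x]=0$, $[a,b]_{\mathfrak g}=[a,b]_{\mathfrak a}+(\omega_{\mathfrak a}(\mathscr D(a),b)+\omega_{\mathfrak a}(a,\mathscr D(b)))x$, $[e,a]=\mathscr D(a)+\omega_{\mathfrak a}(Z_\Omega,a)x$; form $\omega_{\mathfrak g}|_{\mathfrak a\times\mathfrak a}=\omega_{\mathfrak a}$, $\omega_{\mathfrak g}(e,x)=1$, $\mathfrak a\perp x,e$, $\omega_{\mathfrak g}(x,x)=\omega_{\mathfrak g}(e,e)=0$; and $p|2p$-map $a^{[p]_{\mathfrak g}}=a^{[p]_{\mathfrak a}}$ for $a\in\mathfrak a_{\bar 0}$, $e^{[p]_{\mathfrak g}}=a_0+\gamma e$. ''Obtained as'' means equal to such an extension up to an isomorphism of restricted Lie superalgebras preserving the forms. *)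

(* Defs.v *)
From HB Require Import structures.
From mathcomp Require Import all_boot all_order all_algebra.

Set Implicit Arguments.
Unset Strict Implicit.
Unset Printing Implicit Defensive.

Import GRing.Theory.
Local Open Scope ring_scope.

(* Parities are booleans: [gr A false] is the even part and [gr A true] the
   odd part.  The structures below carry raw operations only; the axioms are
   the predicates [lie_superalgebra], [p2p_map], [quasi_frobenius], ... *)
Record superalg (K : fieldType) := Superalg {
  carrier :> vectType K;
  gr : bool -> {vspace carrier};
  br : carrier -> carrier -> carrier
}.
Arguments Superalg {K} carrier gr br.
Arguments gr {K} s _.
Arguments br {K s} _ _.

Section Superalgebras.

Variables (K : fieldType) (A : superalg K).

Record lie_superalgebra : Prop := LieSuperalgebra {
  ls_bilinear : bilinear_for *:%R *:%R (@br K A);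
  ls_direct : directv (gr A false + gr A true);
  ls_full : (gr A false + gr A true)%VS = fullv;
  ls_graded : forall i j (a b : A), a \in gr A i -> b \in gr A j ->
    br a b \in gr A (i (+) j);
  ls_antisym : forall i j (a b : A), a \in gr A i -> b \in gr A j ->
    br a b = - ((-1) ^+ (i && j) *: br b a);
  ls_jacobi : forall i j k (a b c : A),
    a \in gr A i -> b \in gr A j -> c \in gr A k ->
    br a (br b c) = br (br a b) c + (-1) ^+ (i && j) *: br b (br a c);
  ls_cube : forall u : A, u \in gr A true -> br u (br u u) = 0
}.

(* Subspaces such as ideals and orthogonals are predicates on the carrier. *)

Definition is_subspace (I : A -> Prop) : Prop :=
  I 0 /\ (forall (k : K) (u v : A), I u -> I v -> I (k *: u + v)).

Definition is_ideal (I : A -> Prop) : Prop :=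
  is_subspace I /\ (forall a b : A, I a -> I (br a b) /\ I (br b a)).

Definition is_homogeneous (I : A -> Prop) : Prop :=
  forall v, I v -> exists v0 v1 : A,
    [/\ v0 \in gr A false, v1 \in gr A true, v = v0 + v1, I v0 & I v1].

Definition derived (v : A) : Prop :=
  exists s : seq (A * A), v = \sum_(u <- s) br u.1 u.2.

Section PMaps.

Variable p : nat.

(* [s i] stands for s_i(a, b), 0 < i < p.  Comparing coefficients of a
   polynomial in mu of degree at most p - 2 is the same as comparing its
   values at all mu in K, since K has at least p elements. *)
Definition jacobson_terms (a b : A) (s : nat -> A) : Prop :=
  forall mu : K,
    iter p.-1 (br (mu *: a + b)) a
    = \sum_(1 <= i < p) (i%:R * mu ^+ i.-1) *: s i.

(* Only the restriction of [pm] to the even part is meaningful. *)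
Variable pm : A -> A.

Record p_structure_even : Prop := PStructureEven {
  ps_even : forall a : A, a \in gr A false -> pm a \in gr A false;
  ps_ad : forall a b : A, a \in gr A false -> b \in gr A false ->
    br (pm a) b = iter p (br a) b;
  ps_scale : forall (k : K) (a : A), a \in gr A false ->
    pm (k *: a) = k ^+ p *: pm a;
  ps_add : forall a b : A, a \in gr A false -> b \in gr A false ->
    exists2 s, jacobson_terms a b s &
      pm (a + b) = pm a + pm b + \sum_(1 <= i < p) s i
}.

Definition p2p_map : Prop :=
  p_structure_even /\
  (forall a b : A, a \in gr A false -> br (pm a) b = iter p (br a) b).

Definition is_p_ideal (I : A -> Prop) : Prop :=
  [/\ is_ideal I, is_homogeneous I &
      forall a : A, a \in gr A false -> I a -> I (pm a)].

End PMaps.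

Definition antisym_form (om : A -> A -> K) : Prop :=
  bilinear_for *%R *%R om /\
  (forall i j (a b : A), a \in gr A i -> b \in gr A j ->
    om a b = - ((-1) ^+ (i && j) * om b a)).

Definition closed_form (om : A -> A -> K) : Prop :=
  forall i j k (a b c : A), a \in gr A i -> b \in gr A j -> c \in gr A k ->
    (-1) ^+ (i && k) * om a (br b c) + (-1) ^+ (k && j) * om c (br a b)
    + (-1) ^+ (j && i) * om b (br c a) = 0.

Definition nondegenerate_form (om : A -> A -> K) : Prop :=
  forall a : A, (forall b : A, om a b = 0) -> a = 0.

Definition odd_form (om : A -> A -> K) : Prop :=
  forall i (a b : A), a \in gr A i -> b \in gr A i -> om a b = 0.

Definition quasi_frobenius (om : A -> A -> K) : Prop :=
  [/\ antisym_form om, closed_form om & nondegenerate_form om].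

Definition perp (om : A -> A -> K) (S : A -> Prop) (v : A) : Prop :=
  forall w : A, S w -> om v w = 0.

Definition even_derivation (D : 'End(A)) : Prop :=
  (forall i (a : A), a \in gr A i -> D a \in gr A i) /\
  (forall a b : A, D (br a b) = br (D a) b + br a (D b)).

Definition restricted_derivation (p : nat) (pm : A -> A) (D : 'End(A)) : Prop :=
  forall a : A, a \in gr A false -> D (pm a) = iter p.-1 (br a) (D a).

(* [Dstar] is the adjoint of [D], where [D] has parity [d]. *)
Definition is_adjoint (om : A -> A -> K) (d : bool) (D Dstar : 'End(A)) : Prop :=
  forall i (a b : A), a \in gr A i ->
    om (D a) b = (-1) ^+ (i && d) * om a (Dstar b).

(* A word x_1 ... x_p with x_1 = a and x_2 = b is encoded by its tail
   x_3 ... x_p; an entry [true] stands for a, an entry [false] for b. *)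
Definition star_property (p : nat) (alpha : A -> A -> K) (beta : A -> K) : Prop :=
  (forall (k : K) (a : A), a \in gr A false -> beta (k *: a) = k ^+ p * beta a)
  /\
  (forall a b : A, a \in gr A false -> b \in gr A false ->
    beta (a + b) = beta a + beta b +
      \sum_(t : (p - 2).-tuple bool)
        let xs := [seq if c then a else b | c <- t] in
        ((count id t).+1)%:R^-1 * alpha (foldl br a (belast b xs)) (last b xs)).

Definition B2star (p : nat) (pm : A -> A)
    (alpha : A -> A -> K) (beta : A -> K) : Prop :=
  [/\ antisym_form alpha, star_property p alpha beta &
      exists phi : 'Hom(A, K^o),
        (forall a b : A, alpha a b = phi (br a b)) /\
        (forall a : A, a \in gr A false -> beta a = phi (pm a))].

End Superalgebras.

Arguments derived {K A} v.

Record rqf (K : fieldType) := Rqf {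
  alg :> superalg K;
  ppow : alg -> alg;
  qform : alg -> alg -> K
}.
Arguments Rqf {K} alg ppow qform.
Arguments ppow {K} r _.
Arguments qform {K} r _ _.

Definition restricted_periplectic_qF (K : fieldType) (p : nat) (A : rqf K) : Prop :=
  [/\ lie_superalgebra A, p2p_map p (ppow A),
      quasi_frobenius (qform A) & odd_form (qform A)].

Definition rqf_iso (K : fieldType) (A B : rqf K) : Prop :=
  exists f : {linear A -> B},
    [/\ bijective f,
        forall i (a : A), a \in gr A i -> f a \in gr B i,
        forall a b : A, f (br a b) = br (f a) (f b),
        forall a : A, a \in gr A false -> f (ppow A a) = ppow B (f a) &
        forall a b : A, qform B (f a) (f b) = qform A a b].

Section Extension.

Variables (K : fieldType) (p : nat) (A : rqf K).

Local Notation om := (qform A).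

Record ext_data := ExtData {
  edD : 'End(A);
  edDstar : 'End(A);
  ed_gamma : K;
  ed_a0 : A;
  ed_lambda : K;
  edZ : A
}.

Variable d : ext_data.

Local Notation D := (edD d).
Local Notation Ds := (edDstar d).
Local Notation gamma := (ed_gamma d).
Local Notation a0 := (ed_a0 d).
Local Notation lambda := (ed_lambda d).
Local Notation Z := (edZ d).

Definition ext_Omega (a b : A) : K :=
  om (D (D a) + (Ds (D a)) *+ 2 + Ds (Ds a) + lambda *: D a + lambda *: Ds a) b.

Record ext_data_axioms : Prop := ExtDataAxioms {
  ed_derivation : even_derivation D;
  ed_restricted : restricted_derivation p (ppow A) D;
  ed_adjoint : is_adjoint om false D Ds;
  ed_a0_even : a0 \in gr A false;
  ed_Dp : forall a : A, iter p D a = gamma *: D a + br a0 a;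
  ed_Da0 : D a0 = 0;
  ed_B2 : B2star p (ppow A) ext_Omega (fun=> 0);
  ed_Z_even : Z \in gr A false;
  ed_Z_Omega : forall a b : A, ext_Omega a b = om Z (br a b);
  ed_Z_pmap : forall a : A, a \in gr A false -> om Z (ppow A a) = 0;
  ed_lambda_gamma : lambda * gamma = lambda ^+ p;
  ed_Z_a0 : om Z a0 = 0;
  ed_Z_sum :
    \sum_(i < p) (- lambda) ^+ (p.-1 - i) *: iter i Ds Z = Ds a0 + gamma *: Z
}.

(* The triple (r, a, t) stands for r x + a + t e. *)
Definition ext_carrier : vectType K := (K^o * A * K^o)%type.

Definition ext_x : ext_carrier := (1, 0, 0).
Definition ext_e : ext_carrier := (0, 0, 1).
Definition ext_in (a : A) : ext_carrier := (0, a, 0).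

Fact ext_in_is_linear : linear ext_in.
Proof.
by move=> k u v; apply: injective_projections => /=;
  [apply: injective_projections => //= | ]; rewrite scaler0 addr0.
Qed.
HB.instance Definition _ :=
  GRing.isLinear.Build K A ext_carrier _ ext_in ext_in_is_linear.

Definition ext_gr (i : bool) : {vspace ext_carrier} :=
  (linfun ext_in @: gr A i + <[if i then ext_x else ext_e]>)%VS.

(* Bilinear extension of the brackets of generators, with
   [e, x] = - [x, e] = - lambda x and [a, e] = - [e, a]. *)
Definition ext_br (u v : ext_carrier) : ext_carrier :=
  let: (r, a, t) := u in
  let: (r', b, t') := v in
  (om (D a) b + om a (D b) + t * om Z b - t' * om Z a
     + lambda * (r * t' - t * r'),
   br a b + t *: D b - t' *: D a,
   0).

(* omega(e, x) = 1, hence omega(x, e) = -1. *)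
Definition ext_form (u v : ext_carrier) : K :=
  let: (r, a, t) := u in
  let: (r', b, t') := v in
  om a b + t * r' - r * t'.

Definition ext_alg : superalg K := Superalg ext_carrier ext_gr ext_br.

(* A p|2p-map is determined by its values on a basis, so the last two clauses
   pin [pm] down on the even part. *)
Definition ext_pmap (pm : ext_alg -> ext_alg) : Prop :=
  [/\ p2p_map p pm,
      forall a : A, a \in gr A false -> pm (ext_in a) = ext_in (ppow A a) &
      pm ext_e = (0, a0, gamma)].

Definition ext_rqf (pm : ext_alg -> ext_alg) : rqf K := Rqf ext_alg pm ext_form.

End Extension.

Definition symplectic_D0_extension (K : fieldType) (p : nat) (A G : rqf K) : Prop :=
  exists d : ext_data A, ext_data_axioms p d /\
    exists2 pm, ext_pmap p pm & rqf_iso (ext_rqf (d := d) pm) G.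

(* Main.v *)
Require Import Defs.
From HB Require Import structures.
From mathcomp Require Import all_boot all_order all_algebra.
From mathcomp Require Import ring.

(* Since omega is odd and nondegenerate, there is an even e with omega(e, x) = 1,
   and g = Kx + a + Ke for a = {x, e}^perp.  Closedness and omega(x, [g, g]) = 0
   give [x, x^perp] = 0 and [g, g] <= x^perp = Kx + a, so a carries the Lie
   structure of x^perp / Kx, and its p-map is that of g because x^perp is a
   p-ideal.  Writing ad_e on a as D + omega(Z, _) x and e^[p] = a0 + gamma e,
   each axiom on (D, gamma, a0, lambda, Z) is a component, along a or along x, of
   a Jacobi identity or of an identity ad_(y^[p]) = (ad_y)^p in g; the identities
   omega(Z, a^[p]) = omega(Z, a0) = 0 and the star-property hold by parity. *)

Set Implicit Arguments.
Unset Strict Implicit.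
Unset Printing Implicit Defensive.

Import GRing.Theory.
Local Open Scope ring_scope.

(** * Duality for nondegenerate bilinear forms *)

Section Representation.

Variables (K : fieldType) (V : vectType K) (b : V -> V -> K).
Hypothesis b_bilin : bilinear_for *%R *%R b.
Hypothesis b_nondeg : forall a, (forall c, b a c = 0) -> a = 0.

Fact form_right_linear a : linear (b a : V -> K^o).
Proof. exact: b_bilin.2. Qed.
HB.instance Definition _ a :=
  GRing.isLinear.Build K V K^o _ (b a : V -> K^o) (form_right_linear a).

Definition form_hom a : 'Hom(V, K^o) := linfun (b a : V -> K^o).

Lemma form_homE a c : form_hom a c = b a c.
Proof. by rewrite lfunE. Qed.

Fact form_hom_linear : linear form_hom.
Proof.
move=> k u v; apply/lfunP => c; rewrite add_lfunE scale_lfunE !form_homE.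
exact: b_bilin.1.
Qed.
HB.instance Definition _ :=
  GRing.isLinear.Build K V 'Hom(V, K^o) _ form_hom
    form_hom_linear.

(** Nondegeneracy makes [form_hom] injective, and V and its dual have equal dimension; [R] is the
    inverse. *)
Lemma form_represents : exists R : 'Hom('Hom(V, K^o), V),
  forall (phi : 'Hom(V, K^o)) a, b (R phi) a = phi a.
Proof.
pose T := linfun form_hom.
have kT : lker T == 0%VS.
  apply/lker0P => u v; rewrite !lfunE /= => /lfunP Euv.
  apply/eqP; rewrite -subr_eq0 addrC -scaleN1r; apply/eqP/b_nondeg => c.
  have := Euv c; rewrite !form_homE => Ec.
  by rewrite (b_bilin.1 c) Ec /= mulN1r addNr.
have TV : limg T = fullv.
  apply/eqP; rewrite eqEdim subvf limg_dim_eq ?(eqP kT) ?capv0 //.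
  by rewrite !dimvf /dim /= muln1.
exists T^-1%VF => phi a.
have : T (T^-1%VF phi) = phi by rewrite limg_lfunVK // TV memvf.
by move/lfunP/(_ a); rewrite lfunE /= form_homE.
Qed.

Lemma form_adjoint (D : 'End(V)) :
  exists Ds : 'End(V), forall a c, b (Ds a) c = b a (D c).
Proof.
have [R RP] := form_represents.
have ds_lin : linear (fun a => R (form_hom a \o D)%VF).
  move=> k u v; rewrite -linearP; congr (R _); apply/lfunP => c.
  rewrite add_lfunE scale_lfunE !comp_lfunE !form_homE.
  exact: b_bilin.1.
pose dsl : {linear V -> V} :=
  HB.pack (fun a => R (form_hom a \o D)%VF)
    (GRing.isLinear.Build K V V _ _ ds_lin).
by exists (linfun dsl) => a c; rewrite lfunE /= RP comp_lfunE form_homE.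
Qed.

End Representation.

(** * Brackets with even elements and signs of an odd form *)

Section Reduction.

Variables (K : fieldType) (p : nat) (g : rqf K).
Hypotheses (charKp : p \in [pchar K]) (p_gt2 : (2 < p)%N).
Hypothesis hg : restricted_periplectic_qF p g.

Local Notation om := (qform g).

Let LA : lie_superalgebra g. Proof. by case: hg. Qed.
Let pmP : p2p_map p (ppow g). Proof. by case: hg. Qed.
Let om_antisym : antisym_form om. Proof. by case: hg => _ _ []. Qed.
Let om_closed : closed_form om. Proof. by case: hg => _ _ []. Qed.
Let om_nondeg : nondegenerate_form om. Proof. by case: hg => _ _ []. Qed.
Let om_odd : odd_form om. Proof. by case: hg. Qed.

HB.instance Definition _ :=
  bilinear_isBilinear.Build K g g g *:%R *:%R (@br K g) (ls_bilinear LA).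
HB.instance Definition _ :=
  bilinear_isBilinear.Build K g g K *%R *%R om om_antisym.1.

Lemma homogeneous_decomp (v : g) : exists v0 v1,
  [/\ v0 \in gr g false, v1 \in gr g true & v = v0 + v1].
Proof.
have : v \in (gr g false + gr g true)%VS by rewrite (ls_full LA) memvf.
by case/memv_addP => v0 h0 [v1 h1 ->]; exists v0, v1.
Qed.

Lemma br_even_skew (e a : g) : e \in gr g false -> br a e = - br e a.
Proof.
move=> he; have [a0 [a1 [h0 h1 ->]]] := homogeneous_decomp a.
rewrite linearDr linearDl opprD /= (ls_antisym LA h0 he) (ls_antisym LA h1 he).
by rewrite /= expr0 !scale1r.
Qed.

Lemma ad_even_derivation (e a b : g) : e \in gr g false ->
  br e (br a b) = br (br e a) b + br a (br e b).
Proof.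
move=> he; have [a0 [a1 [ha0 ha1 ->]]] := homogeneous_decomp a.
have [b0 [b1 [hb0 hb1 ->]]] := homogeneous_decomp b.
rewrite !(linearDr, linearDl) /=.
rewrite (ls_jacobi LA he ha0 hb0) (ls_jacobi LA he ha0 hb1).
rewrite (ls_jacobi LA he ha1 hb0) (ls_jacobi LA he ha1 hb1).
rewrite /= !expr0 !scale1r.
rewrite (addrACA (br (br e a0) b0)) (addrACA (br (br e a0) b1)) [LHS]addrACA.
by rewrite (addrACA (br a0 (br e b0))).
Qed.

(* The sign (-1)^(|a||b|) only matters when a and b are both odd, where an odd
   form vanishes. *)
Lemma odd_form_skew a b : om a b = - om b a.
Proof.
have H i j c d : c \in gr g i -> d \in gr g j -> om c d = - om d c.
  move=> hc hd; have [eij|nij] := eqVneq i j.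
    by rewrite -eij in hd; rewrite (om_odd hc hd) (om_odd hd hc) oppr0.
  rewrite (om_antisym.2 _ _ _ _ hc hd).
  by case: i j nij {hc hd} => [] [] //= _; rewrite mul1r.
have [a0 [a1 [ha0 ha1 ->]]] := homogeneous_decomp a.
have [b0 [b1 [hb0 hb1 ->]]] := homogeneous_decomp b.
rewrite !(linearDr, linearDl) /=.
rewrite (H _ _ _ _ ha0 hb0) (H _ _ _ _ ha0 hb1).
by rewrite (H _ _ _ _ ha1 hb0) (H _ _ _ _ ha1 hb1); ring.
Qed.

Lemma odd_form_signE i j a b : a \in gr g i -> b \in gr g j ->
  (-1) ^+ (i && j) * om a b = om a b.
Proof.
move=> ha hb; case: i j ha hb => [] [] /= ha hb; rewrite ?expr0 ?mul1r //.
by rewrite (om_odd ha hb) mulr0.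
Qed.

(** The only sign left in the closedness identity when e is even stands before om d [e, c], which
    vanishes when c and d are both odd; so no sign survives. *)
Lemma closed_odd_form_even e a b : e \in gr g false ->
  om e (br a b) = om (br e a) b + om a (br e b).
Proof.
move=> he.
have H i j c d : c \in gr g i -> d \in gr g j ->
    om e (br c d) = om (br e c) d + om c (br e d).
  move=> hc hd; have := om_closed he hc hd; rewrite /= expr0 mul1r andbF.
  rewrite expr0 mul1r (odd_form_signE hd (ls_graded LA he hc)).
  rewrite (br_even_skew d he) linearNr (odd_form_skew d) /= => E.
  by apply/eqP; rewrite -subr_eq0 -E; apply/eqP; ring.
have [a0 [a1 [ha0 ha1 ->]]] := homogeneous_decomp a.
have [b0 [b1 [hb0 hb1 ->]]] := homogeneous_decomp b.
rewrite !(linearDr, linearDl) /=.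
rewrite (H _ _ _ _ ha0 hb0) (H _ _ _ _ ha0 hb1).
by rewrite (H _ _ _ _ ha1 hb0) (H _ _ _ _ ha1 hb1); ring.
Qed.

(** * The ideal Kx and its orthogonal *)

Variables x e : g.
Hypothesis x_odd : x \in gr g true.
Hypothesis e_even : e \in gr g false.
Hypothesis om_ex : om e x = 1.
Hypothesis om_x_br : forall a b, om x (br a b) = 0.
Hypothesis x_ideal : forall a, br a x \in <[x]>%VS.
Hypothesis perp_pm :
  forall a, a \in gr g false -> om a x = 0 -> om (ppow g a) x = 0.

Let om_xe : om x e = -1. Proof. by rewrite odd_form_skew om_ex. Qed.
Let om_xx : om x x = 0. Proof. exact: om_odd x_odd x_odd. Qed.
Let om_ee : om e e = 0. Proof. exact: om_odd e_even e_even. Qed.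
Let om_br_x a b : om (br a b) x = 0.
Proof. by rewrite odd_form_skew om_x_br oppr0. Qed.

(** In the closedness identity for x, a, b the term om x [a, b] is zero, and [b, x] is a multiple of
    x, hence orthogonal to a. What remains says that [x, a] is orthogonal to every b. *)
Lemma br_x_perp_hom j a : a \in gr g j -> om a x = 0 -> br x a = 0.
Proof.
move=> ha ax.
suff H k b : b \in gr g k -> om (br x a) b = 0.
  apply: om_nondeg => b; have [b0 [b1 [hb0 hb1 ->]]] := homogeneous_decomp b.
  by rewrite linearDr /= (H _ _ hb0) (H _ _ hb1) addr0.
move=> hb; have := om_closed x_odd ha hb.
have /vlineP[c ->] := x_ideal b.
rewrite om_x_br linearZr /= ax !mulr0 add0r addr0.
move/eqP; rewrite mulf_eq0 signr_eq0 /= => /eqP E.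
by rewrite odd_form_skew E oppr0.
Qed.

Lemma br_x_perp a : om a x = 0 -> br x a = 0.
Proof.
have [a0 [a1 [h0 h1 ->]]] := homogeneous_decomp a.
have a1x := om_odd h1 x_odd.
rewrite linearDl linearDr /= a1x addr0 => a0x.
by rewrite (br_x_perp_hom h0 a0x) (br_x_perp_hom h1 a1x) addr0.
Qed.

Lemma br_perp_x a : om a x = 0 -> br a x = 0.
Proof.
have [a0 [a1 [h0 h1 ->]]] := homogeneous_decomp a.
have a1x := om_odd h1 x_odd.
rewrite !linearDl /= a1x addr0 => a0x.
rewrite (ls_antisym LA h0 x_odd) (ls_antisym LA h1 x_odd).
by rewrite (br_x_perp_hom h0 a0x) (br_x_perp_hom h1 a1x) !scaler0 oppr0 addr0.
Qed.

Lemma br_ee : br e e = 0.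
Proof.
have h2 : (2%:R : K) != 0.
  rewrite -(dvdn_pcharf charKp).
  by apply/negP => /(dvdn_leq (isT : (0 < 2)%N)); rewrite leqNgt p_gt2.
have := br_even_skew e e_even; move/eqP.
by rewrite -addr_eq0 -mulr2n -scaler_nat scaler_eq0 (negPf h2) => /eqP.
Qed.

(* [i] is the inclusion of {x, e}^perp, [q] the projection along Kx + Ke. *)
Variables (V : vectType K) (i : {linear V -> g}) (q : {linear g -> V}).
Hypothesis iK : cancel i q.
Hypothesis qK : forall v, i (q v) = v - om v x *: e + om v e *: x.

Let i_inj : injective i := can_inj iK.

Let qx : q x = 0.
Proof.
by apply: i_inj; rewrite qK om_xx om_xe scale0r subr0 scaleN1r subrr linear0.
Qed.

Let qe : q e = 0.
Proof.
by apply: i_inj; rewrite qK om_ee om_ex scale0r scale1r subrr addr0 linear0.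
Qed.

Let om_ix a : om (i a) x = 0.
Proof.
have := congr1 (om^~ x) (qK (i a)); rewrite iK !(linearDl, linearNl) /=.
rewrite !linearZl /= om_ex om_xx mulr1 mulr0 addr0 => E.
by rewrite E subrr.
Qed.

Let om_ie a : om (i a) e = 0.
Proof.
have := congr1 (om^~ e) (qK (i a)); rewrite iK !(linearDl, linearNl) /=.
rewrite !linearZl /= om_ee om_xe mulr0 mulrN1 subr0 => E.
by rewrite E subrr.
Qed.

Let om_xi a : om x (i a) = 0. Proof. by rewrite odd_form_skew om_ix oppr0. Qed.
Let om_ei a : om e (i a) = 0. Proof. by rewrite odd_form_skew om_ie oppr0. Qed.

(** * The reduced superalgebra on {x, e}^perp *)

Lemma iq_perp v : om v x = 0 -> i (q v) = v + om v e *: x.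
Proof. by move=> vx; rewrite qK vx scale0r subr0. Qed.

(** By oddness an even v is orthogonal to e, so no x-component has to be removed. This is why the
    p-map restricts without correction. *)
Lemma iq_even v : v \in gr g false -> om v x = 0 -> i (q v) = v.
Proof.
by move=> v0 vx; rewrite iq_perp // (om_odd v0 e_even) scale0r addr0.
Qed.

Lemma iq_hom j v : v \in gr g j -> i (q v) \in gr g j.
Proof.
case: j => hv; rewrite qK.
  by rewrite (om_odd hv x_odd) scale0r subr0 rpredD ?rpredZ.
by rewrite (om_odd hv e_even) scale0r addr0 rpredB ?rpredZ.
Qed.

(** A bracket of two elements of {x, e}^perp is orthogonal to x but perhaps not to e; [q] removes
    its x-component. *)
Definition red_br a b := q (br (i a) (i b)).
Definition red_gr j := (linfun i @^-1: gr g j)%VS.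
Definition red : rqf K :=
  Rqf (Superalg V red_gr red_br) (fun a => q (ppow g (i a)))
    (fun a b => om (i a) (i b)).

Lemma mem_red_gr j (a : V) : (a \in red_gr j) = (i a \in gr g j).
Proof. by rewrite -memv_preim lfunE. Qed.

Lemma q_red_gr j v : v \in gr g j -> q v \in red_gr j.
Proof. by move=> hv; rewrite mem_red_gr iq_hom. Qed.

(** On x^perp, [i (q v)] and v differ by a multiple of x, which x^perp annihilates. Inner
    projections can thus be dropped, and identities of g pass to the reduction. *)
Lemma q_br_ir u v : om u x = 0 -> om v x = 0 -> q (br u (i (q v))) = q (br u v).
Proof.
move=> ux vx; rewrite iq_perp // linearDr linearZr /= br_perp_x //.
by rewrite scaler0 addr0.
Qed.

Lemma q_br_il u v : om u x = 0 -> om v x = 0 -> q (br (i (q u)) v) = q (br u v).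
Proof.
move=> ux vx; rewrite iq_perp // linearDl linearZl /= br_x_perp //.
by rewrite scaler0 addr0.
Qed.

Lemma om_iter_br_x n a v : om v x = 0 -> om (iter n (br a) v) x = 0.
Proof. by case: n => //= n _; rewrite om_br_x. Qed.

Lemma q_iter_br n a v : om v x = 0 ->
  q (iter n (br (i a)) v) = iter n (red_br a) (q v).
Proof.
move=> vx; elim: n => //= n <-; rewrite /red_br q_br_ir //.
exact: om_iter_br_x.
Qed.

Lemma red_lie_superalgebra : lie_superalgebra red.
Proof.
split => /=.
- by split=> [b|a] k u v; rewrite /red_br linearP ?linearPl ?linearPr linearP.
- rewrite directv_addE /= !directvE /= !eqxx /=; apply/eqP/vspaceP => a.
  have /directv_addP gg := ls_direct LA.
  rewrite memv_cap !mem_red_gr -memv_cap gg !memv0.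
  by rewrite -(linear0 i) (inj_eq i_inj).
- apply/vspaceP => a; rewrite memvf.
  have [v0 [v1 [h0 h1 E]]] := homogeneous_decomp (i a).
  by rewrite -[a]iK E linearD memv_add ?q_red_gr.
- move=> j k a b; rewrite !mem_red_gr => ha hb.
  exact/iq_hom/(ls_graded LA).
- move=> j k a b; rewrite !mem_red_gr /red_br => ha hb.
  by rewrite (ls_antisym LA ha hb) linearN linearZ.
- move=> j k l a b c; rewrite !mem_red_gr /red_br => ha hb hc.
  rewrite !q_br_ir // q_br_il // (ls_jacobi LA ha hb hc).
  by rewrite linearD linearZ.
- move=> u; rewrite mem_red_gr /red_br => hu.
  by rewrite q_br_ir // (ls_cube LA hu) linear0.
Qed.

Lemma ppow_even a : a \in gr g false -> ppow g a \in gr g false.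
Proof. by case: pmP => -[h _ _ _] _; apply: h. Qed.

Lemma iq_ppow a : a \in gr g false -> om a x = 0 ->
  i (q (ppow g a)) = ppow g a.
Proof. by move=> ha ax; rewrite iq_even ?ppow_even ?perp_pm. Qed.

Lemma red_p2p_map : p2p_map p (ppow red).
Proof.
have [[_ _ pm_scale pm_add] pm_ad] := pmP.
have ad a b : a \in red_gr false ->
    red_br (q (ppow g (i a))) b = iter p (red_br a) b.
  rewrite mem_red_gr => ha; rewrite /red_br iq_ppow // pm_ad //.
  by rewrite q_iter_br // iK.
split=> /=; last exact: ad.
split=> /=.
- by move=> a; rewrite mem_red_gr => ha; rewrite q_red_gr // ppow_even.
- by move=> a b ha _; apply: ad.
- by move=> k a; rewrite mem_red_gr => ha; rewrite linearZ pm_scale // linearZ.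
- move=> a b; rewrite !mem_red_gr => ha hb.
  have [s sP sE] := pm_add _ _ ha hb; exists (q \o s) => /=.
    move=> mu /=; have := congr1 q (sP mu).
    rewrite -linearZ -linearD q_iter_br // iK => ->.
    by rewrite linear_sum; apply: eq_bigr => j _; rewrite linearZ.
  by rewrite linearD sE !linearD linear_sum.
Qed.

Lemma red_nondegenerate : nondegenerate_form (qform red).
Proof.
move=> a /= H; apply: i_inj; rewrite linear0; apply: om_nondeg => v.
(* The image of [i] is orthogonal to x and e, so only [q v] contributes. *)
have -> : v = i (q v) + om v x *: e - om v e *: x.
  by rewrite qK addrAC addrK addrNK.
by rewrite linearBr linearDr /= !linearZr /= H om_ix om_ie !mulr0 addr0 subr0.
Qed.

Lemma red_restricted_periplectic_qF : restricted_periplectic_qF p red.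
Proof.
split; [exact: red_lie_superalgebra|exact: red_p2p_map| |].
- split; last exact: red_nondegenerate.
  + split=> /=.
      by split=> [b|a] k u v; rewrite linearP ?linearPl ?linearPr.
    move=> j k a b; rewrite !mem_red_gr; exact: om_antisym.2.
  + move=> j k l a b c /=; rewrite !mem_red_gr /red_br => ha hb hc.
    (* The x-components dropped by [q] are orthogonal to the image of [i], so the identity reduces
       to closedness in g. *)
    rewrite !iq_perp // !linearDr !linearZr /= !om_ix !mulr0 !addr0.
    exact: om_closed.
- by move=> j a b /=; rewrite !mem_red_gr; apply: om_odd.
Qed.

(** * The extension data read off from ad_e and e^[p] *)

Variable lam : K.
Hypothesis br_xe : br x e = lam *: x.

Lemma br_ex : br e x = - (lam *: x).
Proof. by rewrite -br_xe (br_even_skew x e_even) opprK. Qed.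

Lemma q_br_e_iq v : om v x = 0 -> q (br e (i (q v))) = q (br e v).
Proof.
move=> vx; rewrite iq_perp // linearDr linearZr /= br_ex linearD linearZ linearN.
by rewrite linearZ /= qx scaler0 oppr0 scaler0 addr0.
Qed.

(** As om e x = 1 and e is orthogonal to the image of [i], the functional om e _ reads off the
    x-coefficient on x^perp. Thus [D] is the component of ad_e along [V], and [Z] represents its
    component along x. *)
Variables (D Ds : 'End(V)) (Z : V).
Hypothesis D_E : forall a, D a = q (br e (i a)).
Hypothesis DsP : forall a b, om (i (Ds a)) (i b) = om (i a) (i (D b)).
Hypothesis ZP : forall a, om (i Z) (i a) = om e (br e (i a)).

Let omA a b := om (i a) (i b).

Lemma br_e_i a : br e (i a) = i (D a) + omA Z a *: x.
Proof.
by rewrite D_E iq_perp // /omA ZP -addrA -scalerDl odd_form_skew addNr scale0r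
  addr0.
Qed.

(** This is the x-coefficient of the bracket, the cocycle in the bracket of the extension. *)
Lemma om_e_br_i a b : om e (br (i a) (i b)) = omA (D a) b + omA a (D b).
Proof.
rewrite closed_odd_form_even // !br_e_i linearDl linearDr /=.
by rewrite linearZl linearZr /= om_xi om_ix !mulr0 !addr0.
Qed.

(** On even a the bracket [e, a] is even, so om e [e, a] = 0 by oddness. Hence the odd component of
    [i Z] is orthogonal to everything. *)
Lemma Z_even : Z \in red_gr false.
Proof.
rewrite mem_red_gr; have [z0 [z1 [h0 h1 E]]] := homogeneous_decomp (i Z).
suff z1_0 : z1 = 0 by rewrite E z1_0 addr0.
apply: om_nondeg => v; have [v0 [v1 [k0 k1 ->]]] := homogeneous_decomp v.
have z1e : om z1 e = 0.
  have := om_ie Z; rewrite E linearDl /= (om_odd h0 e_even) add0r.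
  exact.
rewrite linearDr /= (om_odd h1 k1) addr0.
have -> : v0 = i (q v0) + om v0 x *: e.
  by rewrite qK (om_odd k0 e_even) scale0r addr0 addrNK.
rewrite linearDr linearZr /= z1e mulr0 addr0.
have := ZP (q v0); rewrite E linearDl /= (om_odd h0 (iq_hom k0)) add0r => ->.
exact: om_odd e_even (ls_graded LA e_even (iq_hom k0)).
Qed.

Lemma D_derivation : even_derivation (A := red) D.
Proof.
split=> [j a|a b] /=.
  rewrite D_E !mem_red_gr => ha; apply: iq_hom.
  exact: (ls_graded LA e_even ha).
rewrite !D_E /red_br (q_br_ir (om_ix a)) ?om_br_x // q_br_il ?om_br_x //.
by rewrite -linearD -ad_even_derivation // q_br_e_iq ?om_br_x.
Qed.

(** Apply ad of a^[p] to e: it equals (ad_a)^(p-1) [a, e], and both sides change sign when e is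
    moved to the left. *)
Lemma D_restricted : restricted_derivation (A := red) p (ppow red) D.
Proof.
move=> a /=; rewrite mem_red_gr => ha.
rewrite !D_E iq_ppow // -q_iter_br ?om_br_x //.
have h n v : iter n (br (i a)) (- v) = - iter n (br (i a)) v.
  by elim: n => //= n ->; rewrite linearNr.
have -> : br e (ppow g (i a)) = - br (ppow g (i a)) e.
  by rewrite (br_even_skew _ e_even) opprK.
rewrite pmP.2 // -[in LHS](prednK (ltnW (ltnW p_gt2))) iterSr.
by rewrite (br_even_skew _ e_even) h opprK.
Qed.

Lemma D_adjoint : is_adjoint (qform red) false D Ds.
Proof.
move=> j a b _; rewrite andbF expr0 mul1r /=.
by rewrite odd_form_skew -DsP -odd_form_skew.
Qed.

Lemma om_D_r a b : omA a (D b) = omA (Ds a) b.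
Proof. by rewrite /omA DsP. Qed.

Lemma om_Ds_iter n a b : omA a (iter n D b) = omA (iter n Ds a) b.
Proof. by elim: n a b => //= n IH a b; rewrite om_D_r IH -iterS iterSr. Qed.

Lemma q_iter_br_e n v : om v x = 0 -> q (iter n (br e) v) = iter n D (q v).
Proof.
move=> vx; elim: n => //= n <-; by rewrite D_E q_br_e_iq ?om_iter_br_x.
Qed.

(** The scalar om e^[p] x is the e-coefficient of e^[p], since om e x = 1; e^[p] has no
    x-coefficient because it is even. *)
Definition red_ext_data : ext_data red :=
  @ExtData K red D Ds (om (ppow g e) x) (q (ppow g e)) lam Z.

Local Notation gamma := (om (ppow g e) x).
Local Notation a0 := (q (ppow g e)).

Lemma ppow_eE : ppow g e = i a0 + gamma *: e.
Proof.
by rewrite qK (om_odd (ppow_even e_even) e_even) scale0r addr0 addrNK.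
Qed.

Lemma ext_OmegaE (a b : red) :
  ext_Omega red_ext_data a b = om (i Z) (i (br a b)).
Proof.
rewrite -[br a b]/(red_br a b) /red_br.
rewrite /ext_Omega /= ZP iq_perp ?om_br_x //; set w := br (i a) (i b).
(* The terms in lambda come from the x-component of w, on which ad_e acts by [- lam]. The others
   come from expanding [e, [a, b]] by the derivation rule. *)
have -> : om e (br e (w + om w e *: x)) = om e (br e w) + lam * om e w.
  rewrite linearDr linearZr /= br_ex linearDr linearZr linearNr linearZr /=.
  by rewrite om_ex (odd_form_skew w); ring.
rewrite /w ad_even_derivation // !br_e_i linearDl [br (i a) (_ + _)]linearDr.
rewrite /= linearZl [br (i a) (_ *: _)]linearZr /= br_x_perp // br_perp_x //.
rewrite !scaler0 !addr0 linearDr /= !om_e_br_i !om_D_r /omA.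
rewrite !linearD !linearDl !linearZ !linearZl /=.
ring.
Qed.

(** If c_n is the x-coefficient of (ad_e)^n a, then c_0 = 0 and c_(n+1) = om Z (D^n a) - lambda c_n.
    Solving this and moving the powers of [D] onto [Z] gives the sum; the truncated [n.-1] is
    harmless, as the sum is empty for n = 0. *)
Lemma om_e_iter n a : om e (iter n (br e) (i a)) =
  omA (\sum_(j < n) (- lam) ^+ (n.-1 - j) *: iter j Ds Z) a.
Proof.
elim: n => [|n IH]; first by rewrite /= big_ord0 /omA linear0 linear0l om_ei.
rewrite big_ord_recr /= subnn expr0 scale1r /omA linearD linearDl /=.
have -> : \sum_(j < n) (- lam) ^+ (n - j) *: iter j Ds Z
    = - lam *: \sum_(j < n) (- lam) ^+ (n.-1 - j) *: iter j Ds Z.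
  rewrite scaler_sumr; apply: eq_bigr => j _; rewrite scalerA -exprS.
  by rewrite -subSn ?prednK //; case: n j {IH} => [[]|n j] //=; rewrite -ltnS.
rewrite linearZ linearZl /= -[om (i _) (i a)]IH.
set w := iter n _ _.
have wx : om w x = 0 by exact: om_iter_br_x.
have {1}-> : w = i (q w) + om e w *: x.
  by rewrite iq_perp // -addrA -scalerDl odd_form_skew addNr scale0r addr0.
rewrite !linearDr !linearZr /= br_ex linearNr linearZr /= om_ex -ZP.
rewrite q_iter_br_e // iK -[om (i Z) _]/(omA Z _) om_Ds_iter /omA; ring.
Qed.

Lemma red_a0_even : a0 \in red_gr false.
Proof. by rewrite q_red_gr ?ppow_even. Qed.

Lemma br_ppow_e v : br (ppow g e) v = br (i a0) v + gamma *: br e v.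
Proof. by rewrite {1}ppow_eE linearDl linearZl. Qed.

(** From [e, e] = 0 one gets [e^[p], e] = (ad_e)^p e = 0, and then [e, i a0] = 0 by the
    decomposition of e^[p]. *)
Lemma D_a0 : D a0 = 0.
Proof.
rewrite D_E; have -> : br e (i a0) = 0; last by rewrite linear0.
have : br e (ppow g e) = 0.
  have := br_even_skew (ppow g e) e_even; rewrite pmP.2 //.
  rewrite -(prednK (ltnW (ltnW p_gt2))) iterSr br_ee.
  have -> n : iter n (br e) 0 = 0 by elim: n => //= n ->; rewrite linear0r.
  by move/esym/eqP; rewrite oppr_eq0 => /eqP.
by rewrite {1}ppow_eE linearDr linearZr /= br_ee scaler0 addr0.
Qed.

(** The component along [V] of ad_(e^[p]) = (ad_e)^p. *)
Lemma D_iter_p a : iter p D a = gamma *: D a + red_br a0 a.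
Proof.
rewrite -{1}[a]iK -q_iter_br_e // -pmP.2 // br_ppow_e linearD linearZ /=.
by rewrite -D_E addrC.
Qed.

(** The x-component of the same identity, tested against all a; [om_e_iter] at n = p gives the sum,
    and D a0 = 0 removes a term on the right. *)
Lemma Ds_sum : \sum_(j < p) (- lam) ^+ (p.-1 - j) *: iter j Ds Z
  = Ds a0 + gamma *: Z.
Proof.
apply/eqP; rewrite -subr_eq0; apply/eqP/red_nondegenerate => a /=.
rewrite linearB linearBl /= -[om (i (\sum_(_ < _) _)) _]/(omA _ _) -om_e_iter.
rewrite -pmP.2 // br_ppow_e linearDr linearZr /= om_e_br_i D_a0.
rewrite linearD linearDl linearZ linearZl /= -ZP DsP /omA linear0 linear0l.
ring.
Qed.

(** The same identity evaluated at x reads (-lambda)^p = - gamma lambda, and p is odd. *)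
Lemma lam_gamma : lam * gamma = lam ^+ p.
Proof.
have p_odd : odd p.
  by case: (even_prime (pcharf_prime charKp)) => // p2; move: p_gt2; rewrite p2.
have x_neq0 : x != 0.
  by apply: contra_eq_neq om_ex => ->; rewrite linear0r eq_sym oner_eq0.
have iter_x n : iter n (br e) x = (- lam) ^+ n *: x.
  elim: n => [|n IH]; first by rewrite scale1r.
  by rewrite iterS IH linearZr /= br_ex -scaleNr scalerA exprSr.
have := br_ppow_e x; rewrite pmP.2 // iter_x br_perp_x // add0r br_ex.
rewrite -scaleNr scalerA => /eqP.
rewrite -subr_eq0 -scalerBl scaler_eq0 (negPf x_neq0) orbF subr_eq0.
by rewrite exprNn -signr_odd p_odd mulN1r mulrN eqr_opp mulrC => /eqP.
Qed.

Lemma red_B2star : B2star p (ppow red) (ext_Omega red_ext_data) (fun=> 0).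
Proof.
have [LB _ [[bil _] _ _] _] := red_restricted_periplectic_qF.
have Omega0 a b : a \in red_gr false -> b \in red_gr false ->
    ext_Omega red_ext_data a b = 0.
  move=> ha hb; rewrite ext_OmegaE -/(qform red Z _).
  have := ls_graded LB ha hb => /=; rewrite mem_red_gr => hab.
  by apply: om_odd hab; rewrite -mem_red_gr Z_even.
split.
- split.
    split=> [b|a] k u v; rewrite !ext_OmegaE.
      by rewrite ((ls_bilinear LB).1 b) linearP linearPr.
    by rewrite ((ls_bilinear LB).2 a) linearP linearPr.
  move=> j k a b ha hb; rewrite !ext_OmegaE (ls_antisym LB ha hb).
  by rewrite linearN linearZ linearNr linearZr.
- split=> [k a _|a b ha hb]; first by rewrite mulr0.
  rewrite !add0r big1 // => t _; cbv zeta.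
  (* Only evenness of the letters matters: nested brackets of even elements are even, and [Omega0]
     kills each summand. *)
  set xs := map _ _.
  have hxs : all (fun c => c \in red_gr false) xs.
    by apply/allP => _ /mapP[[] _ ->].
  clearbody xs; rewrite Omega0 ?mulr0 //.
    elim: xs a b ha hb hxs => [|c xs IH] a b ha hb //= /andP[hc hxs].
    by apply: IH => //; apply: (ls_graded LB ha hb).
  elim: xs b hb hxs => //= c xs IH b hb /andP[hc hxs]; exact: IH.
(* The primitive is om Z _; its value at a^[p] vanishes because both arguments are even. *)
- exists (form_hom (qform red) Z); split=> [a b|a ha]; rewrite form_homE //.
    exact: ext_OmegaE.
  apply/esym; apply: om_odd (_ : i (q _) \in gr g false).
    by rewrite -mem_red_gr Z_even.
  by rewrite -mem_red_gr q_red_gr // ppow_even // -mem_red_gr.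
Qed.

Lemma red_ext_data_axioms : ext_data_axioms p red_ext_data.
Proof.
have [LB [[pe _ _ _] _] [_ _ _] odd] := red_restricted_periplectic_qF.
split=> /=.
- exact: D_derivation.
- exact: D_restricted.
- exact: D_adjoint.
- exact: red_a0_even.
- exact: D_iter_p.
- exact: D_a0.
- exact: red_B2star.
- exact: Z_even.
- exact: ext_OmegaE.
- by move=> a ha; apply: (odd _ _ _ Z_even); apply: pe.
- exact: lam_gamma.
- exact: (odd _ _ _ Z_even red_a0_even).
- exact: Ds_sum.
Qed.

(** * The isomorphism between the extension and g *)

Definition of_ext (u : ext_carrier red) : g :=
  u.1.1 *: x + i u.1.2 + u.2 *: e.

(** Coordinates along x, {x, e}^perp and e; the minus sign is there because om x e = -1. *)
Definition to_ext (v : g) : ext_carrier red := (- om v e, q v, om v x).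

Fact of_ext_linear : linear of_ext.
Proof.
move=> k [[r a] t] [[r' a'] t']; rewrite /of_ext /= linearP !scalerDl !scalerDr.
by rewrite -!(scalerA k) (addrACA (k *: (r *: x))) [LHS]addrACA.
Qed.
HB.instance Definition _ :=
  GRing.isLinear.Build K (ext_carrier red) g _ of_ext of_ext_linear.

Lemma to_extK : cancel to_ext of_ext.
Proof.
move=> v; by rewrite /of_ext /= qK scaleNr [- _ + _]addrC addrK addrNK.
Qed.

Lemma of_extK : cancel of_ext to_ext.
Proof.
move=> [[r a] t]; rewrite /of_ext /to_ext /=; congr (_, _, _).
- rewrite !linearDl !linearZl /= om_xe om_ie om_ee; ring.
- by rewrite !linearD !linearZ /= qx qe iK !scaler0 addr0 add0r.
- by rewrite !linearDl !linearZl /= om_xx om_ix om_ex; ring.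
Qed.

Lemma of_ext_br (u v : ext_alg red_ext_data) :
  of_ext (br u v) = br (of_ext u) (of_ext v).
Proof.
apply: (can_inj to_extK); rewrite of_extK.
case: u v => [[r a] t] [[r' b] t'].
have br_e r1 a1 t1 : br e (of_ext (r1, a1, t1))
    = i (D a1) + (omA Z a1 - lam * r1) *: x.
  rewrite /of_ext !linearDr !linearZr /= br_e_i br_ex br_ee scaler0 addr0.
  by rewrite scalerN scalerA [r1 * _]mulrC scalerBl addrC addrA.
rewrite /to_ext om_br_x; congr (_, _, _).
  (* The x-coordinate of a bracket is its pairing with e, which closedness expresses through ad_e
     alone. *)
  rewrite -odd_form_skew closed_odd_form_even // !br_e /of_ext /=.
  rewrite !(linearDl, linearDr) /= !(linearZl, linearZr) /=.
  rewrite !(om_xx, om_xi, om_ix, om_ex, om_xe, om_ei, om_ie) /omA; ring.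
rewrite {1}/of_ext !linearDl !linearZl /= br_e /of_ext /=.
rewrite !linearDr !linearZr /= (br_x_perp (om_ix b)) (br_x_perp om_xx).
rewrite (br_perp_x (om_ix a)) (br_even_skew (i a) e_even) br_e_i br_xe.
rewrite !(linearD, linearN, linearZ) /= !qx !iK linear0.
rewrite !(scaler0, oppr0) !addr0 !add0r.
by rewrite [r *: 0]scaler0 add0r [LHS]addrAC !scalerN.
Qed.

Lemma of_ext_form u v : om (of_ext u) (of_ext v) = ext_form u v.
Proof.
case: u v => [[r a] t] [[r' b] t']; rewrite /of_ext /=.
rewrite !(linearDl, linearDr) /= !(linearZl, linearZr) /=.
rewrite !(om_xx, om_xi, om_ix, om_ex, om_xe, om_ei, om_ie, om_ee); ring.
Qed.

(** The coordinates along x and e are values of the form against e and x, so by oddness the first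
    vanishes on even elements and the second on odd ones. *)
Lemma of_ext_gr j u : (of_ext u \in gr g j) = (u \in ext_gr red j).
Proof.
apply/idP/idP.
  case: u => [[r a] t] hu.
  have ha : a \in red_gr j.
    by rewrite -[a]/((r, a, t).1.2) -[(r, a, t)]of_extK q_red_gr.
  have [r0 t0] : r = - om (of_ext (r, a, t)) e /\ t = om (of_ext (r, a, t)) x.
    by have [] := of_extK (r, a, t).
  have iha : ext_in a \in (linfun (@ext_in K red) @: gr red j)%VS.
    by rewrite -[ext_in a](lfunE (@ext_in K red)) memv_img.
  case: j hu ha iha => hu ha iha.
    have -> : (r, a, t) = ext_in a + r *: ext_x red.
      rewrite [t in LHS]t0 (om_odd hu x_odd).
      by congr (_, _, _); rewrite /= ?scaler0 ?addr0 ?add0r // [r *: 1]mulr1.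
    by rewrite memv_add // memvZ // memv_line.
  have -> : (r, a, t) = ext_in a + t *: ext_e red.
    rewrite [r in LHS]r0 (om_odd hu e_even) oppr0.
    by congr (_, _, _); rewrite /= ?scaler0 ?addr0 ?add0r // [t *: 1]mulr1.
  by rewrite memv_add // memvZ // memv_line.
case/memv_addP => _ /memv_imgP[a ha ->] [_ /vlineP[k ->] ->].
rewrite lfunE /= linearD linearZ /= rpredD //.
  by rewrite /of_ext /= !scale0r add0r addr0 -mem_red_gr.
by case: j {ha}; rewrite rpredZ // /of_ext /= linear0 scale0r scale1r ?addr0
  ?add0r.
Qed.

(** Transporting the p-map of g makes compatibility with the isomorphism automatic; what has to be
    checked is its values on [V] and on e. *)
Definition ext_ppow (u : ext_alg red_ext_data) : ext_alg red_ext_data :=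
  to_ext (ppow g (of_ext u)).

Lemma of_ext_ppow u : of_ext (ext_ppow u) = ppow g (of_ext u).
Proof. exact: to_extK. Qed.

Lemma ext_ppow_p2p_map : p2p_map p ext_ppow.
Proof.
have [[_ _ pm_scale pm_add] pm_ad] := pmP.
have inj := can_inj of_extK.
have iter_br n u v : of_ext (iter n (@br K (ext_alg red_ext_data) u) v)
    = iter n (br (of_ext u)) (of_ext v).
  by elim: n => //= n <-; rewrite of_ext_br.
have ad u v : u \in ext_gr red false ->
    br (ext_ppow u) v = iter p (@br K (ext_alg red_ext_data) u) v.
  rewrite -of_ext_gr => hu; apply: inj.
  by rewrite iter_br of_ext_br of_ext_ppow pm_ad.
split; last exact: ad.
split=> /=.
- by move=> u; rewrite -!of_ext_gr of_ext_ppow; apply: ppow_even.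
- by move=> u v hu _; apply: ad.
- move=> k u; rewrite -of_ext_gr => hu; apply: inj.
  by rewrite linearZ /= !of_ext_ppow linearZ pm_scale.
- move=> u v; rewrite -!of_ext_gr => hu hv.
  have [s sP sE] := pm_add _ _ hu hv; exists (to_ext \o s).
    move=> mu; apply: inj; rewrite iter_br linearD linearZ sP linear_sum.
    by apply: eq_bigr => j _; rewrite linearZ /= to_extK.
  apply: inj; rewrite !linearD /= !of_ext_ppow linearD sE linear_sum.
  by congr (_ + _); apply: eq_bigr => j _; rewrite /= to_extK.
Qed.

Lemma ext_ppow_ext_pmap : ext_pmap p ext_ppow.
Proof.
split; first exact: ext_ppow_p2p_map.
  move=> a /=; rewrite mem_red_gr => ha; apply: (can_inj of_extK).
  rewrite of_ext_ppow /of_ext /= !scale0r add0r addr0.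
  by rewrite iq_ppow // add0r addr0.
rewrite /ext_ppow /of_ext /= scale0r linear0 !add0r scale1r /to_ext.
by rewrite (om_odd (ppow_even e_even) e_even) oppr0.
Qed.

Lemma red_symplectic_D0_extension : symplectic_D0_extension p red g.
Proof.
exists red_ext_data; split; first exact: red_ext_data_axioms.
exists ext_ppow; first exact: ext_ppow_ext_pmap.
exists of_ext; split.
- exact: Bijective of_extK to_extK.
- by move=> j u; rewrite of_ext_gr.
- exact: of_ext_br.
- by move=> u _; apply: of_ext_ppow.
- exact: of_ext_form.
Qed.

End Reduction.

(** * Choice of e, of the complement and of the data *)

Theorem theorem4p2 (K : fieldType) (p : nat)
    (charKp : p \in [pchar K]) (p_gt2 : (2 < p)%N)
    (g : rqf K) (hg : restricted_periplectic_qF p g)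
    (hx : exists x : g,
       [/\ x != 0,
           x \in gr g true,
           perp (qform g) (derived) x,
           is_ideal (fun v : g => v \in <[x]>%VS) &
           is_p_ideal (ppow g) (perp (qform g) (fun v : g => v \in <[x]>%VS))]) :
  exists a : rqf K,
    restricted_periplectic_qF p a /\ symplectic_D0_extension p a g.
Proof.
have [LA pmP [[om_bilin om_sign] om_closed om_nondeg] om_odd] := hg.
have om_skew := odd_form_skew hg.
have [x [x_neq0 x_odd x_perp [_ x_ideal] [_ _ perp_p]]] := hx.
pose om := qform g.
have omDl a b c : om (a + b) c = om a c + om b c.
  by have := om_bilin.1 c 1 a b; rewrite /= scale1r mul1r.
have omZl k a c : om (k *: a) c = k * om a c.
  have om0 : om 0 c = 0.
    by apply: (addrI (om 0 c)); rewrite -omDl !addr0.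
  by have := om_bilin.1 c k a 0; rewrite /= addr0 -/om om0 addr0.
have omZr k a c : om a (k *: c) = k * om a c.
  by rewrite /om om_skew -/om omZl -mulrN /om -om_skew.
have omDr a b c : om c (a + b) = om c a + om c b.
  by rewrite /om om_skew -/om omDl opprD /om -!om_skew.
(* Nondegeneracy gives z with om x z nonzero; the odd part of z pairs to zero with x, so its even
   part, rescaled, serves as e. *)
have [e e_even om_ex] : exists2 e, e \in gr g false & om e x = 1.
  have [z omz] : exists z, form_hom om x z != 0.
    have /lfunPn[z] : form_hom om x != 0.
      apply: contraNneq x_neq0 => hx0; apply/eqP/om_nondeg => b.
      by rewrite -/om -(form_homE (b := om) om_bilin) hx0 lfunE.
    by rewrite [X in _ != X]lfunE; exists z.
  have [z0 [z1 [h0 h1 E]]] := homogeneous_decomp hg z.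
  rewrite (form_homE (b := om) om_bilin) E omDr in omz.
  rewrite {2}/om (om_odd _ _ _ x_odd h1) addr0 in omz.
  exists ((om z0 x)^-1 *: z0); first by rewrite rpredZ.
  by rewrite omZl mulVf // /om om_skew oppr_eq0.
(* The projection onto {x, e}^perp along Kx + Ke; its image [P] becomes the carrier of the reduced
   superalgebra, and idempotence gives [iK]. *)
pose pi v := v - om v x *: e + om v e *: x.
have pi_lin : linear pi.
  move=> k u v; rewrite /pi !omDl !omZl !scalerDl -!scalerA opprD -scalerN.
  by rewrite !scalerDr scalerN (addrACA (k *: u)) [LHS]addrACA.
pose piL : {linear g -> g} :=
  HB.pack pi (GRing.isLinear.Build K g g _ pi pi_lin).
have om_xx : om x x = 0 by exact: (om_odd _ _ _ x_odd x_odd).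
have om_ee : om e e = 0 by exact: (om_odd _ _ _ e_even e_even).
have om_xe : om x e = -1 by rewrite /om om_skew -/om om_ex.
have pi_idem v : pi (pi v) = pi v.
  have pix : om (pi v) x = 0.
    rewrite /pi !omDl -scaleNr !omZl om_ex om_xx.
    ring.
  have pie : om (pi v) e = 0.
    rewrite /pi !omDl -scaleNr !omZl om_xe om_ee.
    ring.
  by rewrite {1}/pi pix pie !scale0r subr0 addr0.
pose P := limg (linfun piL).
have mem_pi v : pi v \in P by rewrite -[pi v](lfunE piL) memv_img ?memvf.
pose i : {linear subvs_of P -> g} := vsval.
pose q : {linear g -> subvs_of P} := vsproj P \o piL.
have qK v : i (q v) = v - om v x *: e + om v e *: x by exact: vsprojK.
have iK : cancel i q.
  move=> a; apply: val_inj; rewrite [LHS]vsprojK //.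
  have /memv_imgP[v _] : vsval a \in P by exact: subvsP.
  by rewrite lfunE /i /= => ->.
have x_br a b : om x (br a b) = 0.
  by apply: x_perp; exists [:: (a, b)]; rewrite big_seq1.
have x_line a : br a x \in <[x]>%VS by case: (x_ideal _ a (memv_line x)).
have perp_pm a : a \in gr g false -> om a x = 0 -> om (ppow g a) x = 0.
  move=> ha ax; apply: (perp_p a ha _ _ (memv_line x)) => w /vlineP[k ->].
  by rewrite -/om omZr ax mulr0.
have red_rpqF : restricted_periplectic_qF p (red i q).
  exact: (red_restricted_periplectic_qF hg x_odd e_even).
exists (red i q); split=> //.
have [_ _ [[red_bilin _] _ red_nondeg] _] := red_rpqF.
have /vlineP[lam br_xe] : br x e \in <[x]>%VS.
  by case: (x_ideal _ e (memv_line x)).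
have br_e_lin : linear (@br K g e) := (ls_bilinear LA).2 e.
pose br_e : {linear g -> g} :=
  HB.pack (@br K g e) (GRing.isLinear.Build K g g _ _ br_e_lin).
pose D : 'End(subvs_of P) := linfun (q \o br_e \o i).
(* The functional a -> om e [e, a]; its representative [R phi] is Z. *)
pose phi : 'Hom(subvs_of P, K^o) := (form_hom om e \o linfun (br_e \o i))%VF.
have [R RP] := form_represents red_bilin red_nondeg.
have [Ds DsP] := form_adjoint red_bilin red_nondeg D.
apply: (red_symplectic_D0_extension charKp p_gt2 hg x_odd e_even om_ex x_br
  x_line perp_pm iK qK br_xe (D := D) (Ds := Ds) (Z := R phi)).
- by move=> a; rewrite lfunE.
- exact: DsP.
- move=> a; rewrite -[LHS]/(qform (red i q) (R phi) a) RP comp_lfunE.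
  by rewrite (form_homE (b := om) om_bilin) lfunE.
Qed.
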